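(* Let $\alpha\in(0,1]$ and let $E\subseteq\mathbb{R}^2$ be an $F^+_\alpha$-set. Let $h\in\mathbb{H}$ be a dimension function for which there are constants $C>0$ and $\theta>\frac{1+2\alpha}{2\alpha}$ such that $$h(x)\ge C\, x^{\alpha}\sqrt{x}\,\log^{\theta}\!\left(\tfrac1x\right)$$ for all sufficiently small $x>0$. Then $\mathcal{H}^{h}(E)>0$.
   Context: Dimension functions: $\mathbb{H}$ is the set of functions $h:[0,\infty)\to[0,\infty)$ that are non-decreasing, right continuous, and satisfy $h(0)=0$. Hausdorff measures: for $h\in\mathbb{H}$, $E\subseteq\mathbb{R}^2$ and $\delta>0$, $\mathcal{H}^h_\delta(E)=\inf\{\sum_i h(\operatorname{diam}(E_i)) : E\subseteq\bigcup_{i=1}^\infty E_i,\ \operatorname{diam}(E_i)<\delta\}$, and $\mathcal{H}^h(E)=\sup_{\delta>0}\mathcal{H}^h_\delta(E)$. $\mathcal{H}^\alpha$ denotes $\mathcal{H}^{h}$ with $h(x)=x^\alpha$. A set $E\subseteq\mathbb{R}^2$ is an $F^+_\alpha$-set if for each direction $e$ in the unit circle $\mathbb{S}$ there is a line segment $\ell_e$ in the direction of $e$ such that $\mathcal{H}^{\alpha}(\ell_e\cap E)>0$. Notation: $\log^{p}(y)=(\log y)^p$. *)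

(* Defs.v *)
From HB Require Import structures.
From mathcomp Require Import all_boot all_order all_algebra.
From mathcomp Require Import all_classical all_reals all_analysis.
Set Implicit Arguments.
Unset Strict Implicit.
Unset Printing Implicit Defensive.
Import Order.TTheory GRing.Theory Num.Theory.
Import numFieldNormedType.Exports.
Local Open Scope classical_set_scope.
Local Open Scope ring_scope.

(* The canonical norm on R * R is the sup norm, so the Euclidean one is
   introduced explicitly. *)
Definition eucl_norm (R : realType) (u : R * R) : R :=
  Num.sqrt (u.1 ^+ 2 + u.2 ^+ 2).

(* 0 is added to the set of distances so that diam set0 = 0 (and not -oo). *)
Definition diam (R : realType) (A : set (R * R)) : \bar R :=
  ereal_sup ([set 0%E] `|`
             [set (eucl_norm (u - v))%:E | u in A & v in A]).

(* A dimension function is a function [0, +oo[ -> [0, +oo[; it is represented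
   by a function on R whose values on ]-oo, 0[ are irrelevant. *)
Definition dimension_function (R : realType) (h : R -> R) : Prop :=
  [/\ forall x, 0 <= x -> 0 <= h x,
      forall x y, 0 <= x -> x <= y -> h x <= h y,
      forall x, 0 <= x -> h y @[y --> x^'+] --> h x
    & h 0 = 0].

(* [fine] is harmless: covering sets have diameter < delta, hence finite. *)
Definition hausdorff_delta (R : realType) (h : R -> R) (delta : R)
    (E : set (R * R)) : \bar R :=
  ereal_inf [set (\sum_(0 <= i <oo) (h (fine (diam (F i))))%:E)%E |
    F in [set F : nat -> set (R * R) |
            E `<=` \bigcup_i F i /\ forall i, (diam (F i) < delta%:E)%E]].

Definition hausdorff (R : realType) (h : R -> R) (E : set (R * R)) : \bar R :=
  ereal_sup [set hausdorff_delta h delta E | delta in [set d : R | 0 < d]].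

Definition unit_circle (R : realType) : set (R * R) :=
  [set e | eucl_norm e = 1].

Definition line_segment (R : realType) (a e : R * R) (L : R) : set (R * R) :=
  [set a + t *: e | t in `[0, L]].

Definition Fplus_set (R : realType) (alpha : R) (E : set (R * R)) : Prop :=
  forall e : R * R, unit_circle e ->
    exists (a : R * R) (L : R), 0 < L /\
      (0 < hausdorff (fun x : R => (x `^ alpha)%R) (line_segment a e L `&` E))%E.

(* Main.v *)
Require Import Defs.
From HB Require Import structures.
From mathcomp Require Import all_boot all_order all_algebra.
From mathcomp Require Import all_classical all_reals all_analysis.
From mathcomp Require Import ring lra.
Set Implicit Arguments.
Unset Strict Implicit.
Unset Printing Implicit Defensive.
Import Order.TTheory GRing.Theory Num.Theory.
Import numFieldNormedType.Exports.
Local Open Scope classical_set_scope.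
Local Open Scope ring_scope.

(** The argument is Wolff's pair counting for Furstenberg sets, in a form that
sums over all dyadic scales.

Directions are parametrized by slopes [t] in [[0, 1[], and distances along a
line of slope [t] are measured on first coordinates. By countable
subadditivity of the outer Lebesgue measure on slopes there is one [c > 0]
such that the slopes whose line meets [E] in a set of [alpha]-content at least
[c] form a set [Omega] that is not null. Outer measure is used because nothing
makes [Omega] measurable.

Let [(F j)] cover [E] by sets of small diameter, sorted by scales: [F j] has
scale [k] when its diameter lies between [rho k] and [2 * rho k], where
[rho k = 2 ^- k.+1]. Let [M k] be the number of sets of scale [k]. Fix a slope
of [Omega] and call [S] its line section.

- If at every scale [k] one could remove from [S] a piece of diameter
  [4 * d k], chosen so that its [alpha]-content is at most [a k], in such a way
  that fewer than [a k / (2 * rho k) `^ alpha] sets of scale [k] meet what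
  remains, then [S] would have content less than twice the sum of the [a k].
  With that sum below [c / 2] this is impossible. So at some scale, about
  [a k / rho k `^ alpha] sets meet [S] far from any prescribed point
  ([scale_pigeonhole]). Hence about [(a k / rho k `^ alpha) ^+ 2] pairs of sets
  of scale [k] are joined by [S] at distance at least [d k].
- A pair of sets of diameter at most [2 * rho k] at distance [d k] determines
  the slope of a line meeting both up to [8 * rho k / d k]. Counting pairs
  against cells of length [rho k], the slopes served by scale [k] have measure
  at most a constant times
  [M k ^+ 2 * rho k / (d k * (a k / rho k `^ alpha) ^+ 2)]
  ([slopes_at_scale]).

With [a k] proportional to [k.+1 `^ (- p)] and [p = 2 alpha theta / (1 + 2
alpha)], that bound is exactly a constant times [(M k * H k) ^+ 2], where [H k]
is the assumed lower bound of [h] at [rho k] ([threshold_sequences]). The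
hypothesis on [theta] says precisely that [p > 1], which makes the [a k]
summable. If the cover had total [h]-mass at most [e], then the sum of the
[M k * H k] would be at most [e], and [Omega] would have measure at most
[K * e ^+ 2] ([sparse_cover_few_slopes]): a contradiction when [e] is small.
Keeping the squares [(M k * H k) ^+ 2] until the sum over [k], and not
selecting one scale for most slopes, is what yields the exponent [theta]. *)

(** * Diameters *)

Lemma abs_fst_le_eucl_norm (R : realType) (u : R * R) :
  `|u.1| <= eucl_norm u.
Proof.
rewrite -sqrtr_sqr /eucl_norm ler_sqrt ?lerDl ?sqr_ge0 //.
by rewrite addr_ge0 ?sqr_ge0.
Qed.

Lemma abs_snd_le_eucl_norm (R : realType) (u : R * R) :
  `|u.2| <= eucl_norm u.
Proof.
rewrite -sqrtr_sqr /eucl_norm ler_sqrt ?lerDr ?sqr_ge0 //.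
by rewrite addr_ge0 ?sqr_ge0.
Qed.

Lemma eucl_norm_le_sum (R : realType) (u : R * R) :
  eucl_norm u <= `|u.1| + `|u.2|.
Proof.
have h : 0 <= `|u.1| + `|u.2| by rewrite addr_ge0.
rewrite /eucl_norm -[leRHS]ger0_norm // -sqrtr_sqr ler_sqrt ?sqr_ge0 //.
rewrite sqrrD !real_normK ?num_real //.
have : 0 <= `|u.1| * `|u.2| by rewrite mulr_ge0.
lra.
Qed.

Lemma diam_ge0 (R : realType) (A : set (R * R)) : (0 <= diam A)%E.
Proof. by apply: ereal_sup_ubound; left. Qed.

Lemma fin_diam (R : realType) (A : set (R * R)) (c : R) :
  (diam A < c%:E)%E -> (fine (diam A))%:E = diam A.
Proof.
move=> Ac; rewrite fineK // ge0_fin_numE ?diam_ge0 //.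
exact: lt_trans Ac (ltry _).
Qed.

Lemma fine_diam_ge0 (R : realType) (A : set (R * R)) : 0 <= fine (diam A).
Proof. by rewrite fine_ge0 ?diam_ge0. Qed.

Lemma eucl_norm_le_diam (R : realType) (A : set (R * R)) (c : R) u v :
  (diam A < c%:E)%E -> A u -> A v -> eucl_norm (u - v) <= fine (diam A).
Proof.
move=> Ac Au Av; rewrite -lee_fin (fin_diam Ac).
by apply: ereal_sup_ubound; right; exists u => //; exists v.
Qed.

Lemma diam_le (R : realType) (A : set (R * R)) (c : R) :
  0 <= c -> (forall u v, A u -> A v -> eucl_norm (u - v) <= c) ->
  (diam A <= c%:E)%E.
Proof.
move=> c0 Ac; apply: ge_ereal_sup => _ [-> | [u Au [v Av <-]]];
  by rewrite lee_fin // Ac.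
Qed.

Lemma diam_set0 (R : realType) : diam (set0 : set (R * R)) = 0%E.
Proof. by apply/eqP; rewrite eq_le diam_ge0 andbT diam_le. Qed.

(** * Positivity of Hausdorff measure through partial sums *)

(** Positivity of the Hausdorff measure in a form free of extended reals. The
single parameter [c] bounds both the diameters and the mass, so that sets can
be sorted into countably many classes [c = m.+1%:R^-1]. *)
Definition massive (R : realType) (g : R -> R) (c : R) (S : set (R * R)) :=
  forall F : nat -> set (R * R),
    S `<=` \bigcup_i F i -> (forall i, (diam (F i) < c%:E)%E) ->
    exists n, c <= \sum_(i < n) g (fine (diam (F i))).

Lemma massive_le (R : realType) (g : R -> R) (c c' : R) S :
  c' <= c -> massive g c S -> massive g c' S.
Proof.
move=> cc gc F SF Fc; have [|n cn] := gc F SF.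
  by move=> i; rewrite (lt_le_trans (Fc i)) ?lee_fin.
by exists n; exact: le_trans cn.
Qed.

Lemma hausdorff_gt0P (R : realType) (g : R -> R) (S : set (R * R)) :
  (forall x, 0 <= x -> 0 <= g x) ->
  (0 < hausdorff g S)%E <-> exists2 c, 0 < c & massive g c S.
Proof.
move=> g0; have gF0 (F : nat -> set (R * R)) i : 0 <= g (fine (diam (F i))).
  by rewrite g0 ?fine_diam_ge0.
split=> [hS | [c c0 gc]].
- have [_ [d d0 <-] hd] := ereal_sup_gt hS.
  have [e e0 ed] : exists2 e : R, 0 < e & (e%:E <= hausdorff_delta g d S)%E.
    move: hd; case: (hausdorff_delta g d S) => [r r0|_|//].
      by exists r.
    by exists 1 => //; rewrite leey.
  exists (Num.min d (e / 2)); first by rewrite lt_min d0 divr_gt0.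
  move=> F SF Fd; apply: contrapT => /forallNP nF.
  suff : (e%:E <= (e / 2)%:E)%E by rewrite lee_fin; lra.
  apply: (le_trans ed); apply: (@le_trans _ _
     (\sum_(0 <= i <oo) (g (fine (diam (F i))))%:E)%E).
    apply: ereal_inf_lbound; exists F => //; split=> // i.
    by apply: (lt_le_trans (Fd i)); rewrite lee_fin ge_min lexx.
  apply: lime_le.
    by apply: is_cvg_nneseries => i _ _; rewrite lee_fin.
  apply: nearW => n; rewrite big_mkord sumEFin lee_fin.
  have /negP := nF n; rewrite -ltNge => /ltW/le_trans -> //.
  by rewrite ge_min lexx orbT.
- apply: (@lt_le_trans _ _ c%:E); first by rewrite lte_fin.
  apply: (@le_trans _ _ (hausdorff_delta g c S)); last first.
    by apply: ereal_sup_ubound; exists c.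
  apply: le_ereal_inf_tmp => _ [F [SF Fc] <-].
  have [n cn] := gc F SF Fc.
  apply: (@le_trans _ _ (\sum_(0 <= i < n) (g (fine (diam (F i))))%:E)%E).
    by rewrite big_mkord sumEFin lee_fin.
  by apply: nneseries_lim_ge => i _; rewrite lee_fin.
Qed.

(** * Line sections *)

(** The only feature of a line that the counting uses. *)
Definition has_slope (R : realType) (t : R) (S : set (R * R)) :=
  forall u v, S u -> S v -> u.2 - v.2 = t * (u.1 - v.1).

(** The unit vector proportional to [(1, t)] points in the direction of slope
[t]. *)
Lemma Fplus_massive_slope (R : realType) (alpha : R) (E : set (R * R)) :
  Fplus_set alpha E -> forall t : R, exists S c,
    [/\ S `<=` E, has_slope t S, 0 < c &
        massive (fun x => x `^ alpha) c S].
Proof.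
move=> FE t; set s := Num.sqrt (1 + t ^+ 2).
have t2 : 0 < 1 + t ^+ 2 by rewrite ltr_wpDr ?sqr_ge0.
have s0 : 0 < s by rewrite sqrtr_gt0.
have s2 : s ^+ 2 = 1 + t ^+ 2 by rewrite sqr_sqrtr // ltW.
have [|a [L [L0]]] := FE (s^-1, t / s).
  rewrite /unit_circle /= /eucl_norm /= -[RHS]sqrtr1; congr Num.sqrt.
  by rewrite expr_div_n exprVn s2; field; rewrite gt_eqF.
move=> /hausdorff_gt0P [|c c0 mc]; first by move=> x _; exact: powR_ge0.
exists (line_segment a (s^-1, t / s) L `&` E), c; split => //.
move=> u v [[x _ <-] _] [[y _ <-] _] /=; rewrite /GRing.scale /=; ring.
Qed.

(** * A scale at which a cover is spread along a line section *)

Lemma sum_ord_le (R : numDomainType) (Q : pred nat) (w : nat -> R) (n b : nat) :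
  (forall j, 0 <= w j) -> (forall j, Q j -> (j < b)%N) ->
  \sum_(j < n | Q j) w j <= \sum_(j < b | Q j) w j.
Proof.
move=> w0 Qb; pose m := maxn n b.
rewrite (big_ord_widen_cond m Q w (leq_maxl n b)).
rewrite (big_ord_widen_cond m Q w (leq_maxr n b)).
rewrite [leRHS](eq_bigl (fun j : 'I_m => Q j)); last first.
  by move=> j; case Qj: (Q j) => //=; rewrite Qb.
by rewrite big_mkcondr; apply: ler_sum => j _; case: ifP.
Qed.

Lemma sum_fiber (R : zmodType) (w : R) (m K : nat) :
  (m < K)%N -> \sum_(k < K | m == k) w = w.
Proof.
by move=> mK; rewrite (eq_bigl (pred1 (Ordinal mK))) ?big_pred1_eq.
Qed.

Lemma sum_interleave (R : zmodType) (x y : nat -> R) (n : nat) :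
  \sum_(i < n.*2) (if odd i then x i./2 else y i./2) =
  \sum_(i < n) x i + \sum_(i < n) y i.
Proof.
elim: n => [|n IH]; first by rewrite !big_ord0 addr0.
rewrite doubleS !big_ord_recr /= IH /= odd_double /= uphalf_double doubleK.
by rewrite addrAC [in RHS]addrACA addrA.
Qed.

Definition far_indices (R : realType) (S : set (R * R))
    (F : nat -> set (R * R)) (J : nat -> Prop) (b : nat) (d x : R) :
    {set 'I_b} :=
  [set j : 'I_b | `[< J j /\ exists2 q, (F j `&` S) q & d < `|q.1 - x| >]]%SET.

(** If the conclusion failed, each scale [k] would have a point [x k] such that
few sets of scale [k] meet [S] away from [x k]. Those few sets, the pieces of
[S] near the points [x k], and the sets of the cover of diameter [0] would
cover [S] with total mass below [c]. The sets of diameter [0] belong to no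
scale; they are harmless because [0 `^ alpha = 0]. *)
Lemma scale_pigeonhole (R : realType) (alpha t c : R) (S : set (R * R))
    (F : nat -> set (R * R)) (kf b : nat -> nat) (a d u : nat -> R) :
  0 < alpha -> `|t| <= 1 -> has_slope t S ->
  massive (fun x => x `^ alpha) c S ->
  S `<=` \bigcup_j F j -> (forall j, (diam (F j) < c%:E)%E) ->
  (forall j, 0 < fine (diam (F j)) ->
     (j < b (kf j))%N /\ fine (diam (F j)) <= u (kf j)) ->
  (forall k, [/\ 0 <= d k, 4 * d k < c & (4 * d k) `^ alpha <= a k]) ->
  (forall N, \sum_(k < N) a k < c / 2) ->
  exists k, forall x, a k <= #|far_indices S F
     (fun j => 0 < fine (diam (F j)) /\ kf j = k) (b k) (d k) x|%:R *
     u k `^ alpha.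
Proof.
move=> alpha0 t1 St mS SF Fc Fu Hd Ha; apply: contrapT => /forallNP nk.
have /choice[x xP] : forall k, exists x, \sum_(j < b k |
     `[< (0 < fine (diam (F j)) /\ kf j = k) /\
         exists2 q, (F j `&` S) q & d k < `|q.1 - x| >]) u k `^ alpha < a k.
  move=> k; have /existsNP[x /negP] := nk k.
  rewrite -ltNge => far; exists x; apply: le_lt_trans far.
  by rewrite mulr_natl -sumr_const; under [leRHS]eq_bigl do rewrite inE.
pose rel j := exists2 q, (F j `&` S) q & d (kf j) < `|q.1 - x (kf j)|.
(* [X] are the parts of the cover that are kept, [Y] the pieces removed. *)
pose X j := [set q | F j q /\ (0 < fine (diam (F j)) -> rel j)].
pose Y k := [set q | S q /\ `|q.1 - x k| <= d k].
pose w j := (if `[< 0 < fine (diam (F j)) /\ rel j >]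
             then u (kf j) `^ alpha else 0).
have XF j : (diam (X j) <= diam (F j))%E.
  rewrite -(fin_diam (Fc j)); apply: diam_le; first exact: fine_diam_ge0.
  by move=> p q [Fp _] [Fq _]; exact: eucl_norm_le_diam (Fc j) _ _.
have Xc j : (diam (X j) < c%:E)%E by exact: le_lt_trans (XF j) (Fc j).
have Xw j : fine (diam (X j)) `^ alpha <= w j.
  rewrite /w; case: asboolP => [[r0 _] | nr].
    apply: (ge0_ler_powR (ltW alpha0)); rewrite ?nnegrE ?fine_diam_ge0 //.
      exact: le_trans (ltW r0) (Fu j r0).2.
    apply: le_trans (Fu j r0).2.
    by rewrite -lee_fin (fin_diam (Xc j)) (fin_diam (Fc j)).
  have -> : fine (diam (X j)) = 0; last by rewrite powR0 ?gt_eqF.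
  have [r0|r0] := ltP 0 (fine (diam (F j))).
    suff -> : X j = set0 by rewrite diam_set0.
    by rewrite -subset0 => q [_ /(_ r0) relj]; apply: nr.
  apply/eqP; rewrite eq_le fine_diam_ge0 andbT; apply: le_trans r0.
  by rewrite -lee_fin (fin_diam (Xc j)) (fin_diam (Fc j)).
have Yd k : (diam (Y k) <= (4 * d k)%:E)%E.
  have [d0 _ _] := Hd k; apply: diam_le; first by rewrite mulr_ge0.
  move=> p q [Sp px] [Sq qx]; apply: le_trans (eucl_norm_le_sum _) _ => /=.
  rewrite (St p q Sp Sq) normrM.
  have pq : `|p.1 - q.1| <= 2 * d k.
    have -> : p.1 - q.1 = (p.1 - x k) - (q.1 - x k) by ring.
    by apply: le_trans (ler_normB _ _) _; lra.
  have : `|t| * `|p.1 - q.1| <= 1 * `|p.1 - q.1| by rewrite ler_wpM2r.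
  lra.
have Yc k : (diam (Y k) < c%:E)%E.
  by apply: le_lt_trans (Yd k) _; rewrite lte_fin; have [] := Hd k.
have Ya k : fine (diam (Y k)) `^ alpha <= a k.
  have [d0 _ da] := Hd k; apply: le_trans da.
  apply: (ge0_ler_powR (ltW alpha0)); rewrite ?nnegrE ?fine_diam_ge0 //.
    by rewrite mulr_ge0.
  by rewrite -lee_fin (fin_diam (Yc k)).
have a0 k : 0 <= a k by apply: le_trans (Ya k); exact: powR_ge0.
pose G i := if odd i then X i./2 else Y i./2.
have [||n cn] := mS G.
- move=> q Sq; have [j _ Fq] := SF q Sq.
  have [r0|r0] := ltP 0 (fine (diam (F j))); last first.
    exists j.*2.+1 => //; rewrite /G /= odd_double /= uphalf_double.
    by split=> // r0'; move: r0; rewrite leNgt r0'.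
  have [qx|qx] := leP `|q.1 - x (kf j)| (d (kf j)).
    by exists (kf j).*2 => //; rewrite /G odd_double doubleK.
  exists j.*2.+1 => //; rewrite /G /= odd_double /= uphalf_double.
  by split=> // _; exists q.
- by move=> i; rewrite /G; case: ifP.
have [K Kn] : exists K, forall j, (j < n)%N -> (kf j < K)%N.
  exists (\max_(j < n) kf j).+1 => j jn; rewrite ltnS.
  exact: (leq_bigmax (Ordinal jn)).
suff : \sum_(i < n) fine (diam (G i)) `^ alpha < c by rewrite ltNge cn.
have /le_lt_trans -> // : \sum_(i < n) fine (diam (G i)) `^ alpha <=
    \sum_(i < n) w i + \sum_(i < n) a i.
  rewrite -sum_interleave.
  apply: le_trans (_ : \sum_(i < n.*2) fine (diam (G i)) `^ alpha <= _).
    have nn : (n <= n.*2)%N by rewrite -addnn leq_addr.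
    rewrite (big_ord_widen _ (fun i => fine (diam (G i)) `^ alpha) nn).
    rewrite big_mkcond; apply: ler_sum => i _.
    by case: ifP => // _; exact: powR_ge0.
  by apply: ler_sum => i _; rewrite /G; case: ifP.
suff wn : \sum_(i < n) w i <= \sum_(k < K) a k.
  by have := Ha n; have := Ha K; lra.
rewrite (eq_bigr (fun j : 'I_n => \sum_(k < K | kf j == k) w j)); last first.
  by move=> j _; rewrite sum_fiber // Kn.
rewrite (exchange_big_dep predT) //=; apply: ler_sum => k _.
apply: le_trans (ltW (xP k)).
pose Q j := `[< (0 < fine (diam (F j)) /\ kf j = k) /\
         exists2 q, (F j `&` S) q & d k < `|q.1 - x k| >].
apply: le_trans (sum_ord_le (Q := Q) (w := fun=> u k `^ alpha) n _ _).
- rewrite le_eqVlt; apply/orP; left; apply/eqP.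
  rewrite [LHS]big_mkcond [RHS]big_mkcond; apply: eq_bigr => j _; rewrite /w /Q.
  case: eqP => [kj|kj]; last by case: asboolP => // -[[]].
  rewrite -kj; case: asboolP => [[r0 rj]|nr].
  by case: asboolP => // -[].
  by case: asboolP => // -[[r0 _] rj]; case: nr.
- by move=> j; exact: powR_ge0.
- by move=> j /asboolP[[r0 <-] _]; have [] := Fu j r0.
Qed.

(** * Pairs of small sets and slopes *)

(** Moving both ends of a segment by at most [u] changes each coordinate of the
difference of the ends by at most [2 * u]; the slope is the quotient of these
coordinates, and its denominator is at least [d]. *)
Lemma slope_close (R : realType) (t t' d u : R) (p q p' q' : R * R) :
  `|t'| <= 1 ->
  p.2 - q.2 = t * (p.1 - q.1) -> p'.2 - q'.2 = t' * (p'.1 - q'.1) ->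
  eucl_norm (p' - p) <= u -> eucl_norm (q' - q) <= u ->
  d <= `|p.1 - q.1| -> `|t' - t| * d <= 4 * u.
Proof.
move=> t1 St St' pu qu dpq.
apply: le_trans (_ : `|t' - t| * `|p.1 - q.1| <= _); first exact: ler_wpM2l.
rewrite -normrM.
have -> : (t' - t) * (p.1 - q.1) =
    (p' - p).2 - (q' - q).2 - t' * ((p' - p).1 - (q' - q).1).
  by rewrite mulrBl -St /= -[LHS]addr0 -(subrr (p'.2 - q'.2)) {2}St'; ring.
have := abs_fst_le_eucl_norm (p' - p); have := abs_fst_le_eucl_norm (q' - q).
have := abs_snd_le_eucl_norm (p' - p); have := abs_snd_le_eucl_norm (q' - q).
set x := (p' - p).1; set y := (q' - q).1.
set z := (p' - p).2; set w := (q' - q).2 => hw hz hy hx.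
have := ler_normB (z - w) (t' * (x - y)); rewrite normrM.
have : `|t'| * `|x - y| <= 1 * `|x - y| by rewrite ler_wpM2r.
have := ler_normB x y; have := ler_normB z w; lra.
Qed.

Lemma card_le_spread (N B : nat) (A : {set 'I_N}) :
  (forall i j, i \in A -> j \in A -> (i <= j + B)%N) -> (#|A| <= B.+1)%N.
Proof.
move=> AB; have [->|/finset.set0Pn[i0 i0A]] := eqVneq A finset.set0.
  by rewrite cards0.
have [i iA imin] := arg_minnP (fun i : 'I_N => i : nat) i0A.
have iB j : j \in A -> (j - i < B.+1)%N.
  by move=> jA; rewrite ltnS leq_subLR AB.
pose shift (j : 'I_N) : 'I_B.+1 := inord (j - i).
rewrite -[leqRHS]card_ord -(@card_in_imset _ _ shift).
  exact: max_card.
move=> j k jA kA /(congr1 val); rewrite /= !inordK ?iB // => jk.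
by apply: val_inj; rewrite /= -(subnK (imin _ jA)) jk subnK // imin.
Qed.

(** Incidences between indices [g] and pairs [(i, j)], counted in both
orders. *)
Lemma double_count (R : realDomainType) (I J : finType) (A : {set I})
    (M : {set J}) (W : I -> J -> J -> bool) (m L : R) :
  (forall g, g \in A -> m <= \sum_(i in M) \sum_(j in M) (W g i j)%:R) ->
  (forall i j, i \in M -> j \in M -> \sum_(g in A) (W g i j)%:R <= L) ->
  #|A|%:R * m <= #|M|%:R ^+ 2 * L.
Proof.
move=> mW WL; rewrite mulr_natl -sumr_const.
apply: le_trans (_ : \sum_(g in A) \sum_(i in M) \sum_(j in M)
  (W g i j)%:R <= _).
  exact: ler_sum.
rewrite exchange_big /= expr2 -mulrA mulr_natl -sumr_const.
apply: ler_sum => i iM; rewrite exchange_big /= mulr_natl -sumr_const.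
by apply: ler_sum => j jM; exact: WL.
Qed.

(** Bundling the Lebesgue outer measure gives subadditivity on sets that
are not measurable. *)
Definition outer_lebesgue (R : realType) :
  {outer_measure set (ocitv_type R) -> \bar R} := mu_ext (@wlength R idfun).

Lemma outer_lebesgue_itvcc (R : realType) (a b : R) : a <= b ->
  outer_lebesgue R `[a, b]%classic = (b - a)%:E.
Proof.
move=> ab; have := lebesgue_measure_itv `[a, b]; rewrite /= lte_fin.
case: ltP => [_ //|ba]; have -> : a = b by apply/eqP; rewrite eq_le ab ba.
by rewrite subrr.
Qed.

Lemma outer_lebesgue_itvco (R : realType) (a b : R) : a < b ->
  outer_lebesgue R `[a, b[%classic = (b - a)%:E.
Proof.
by move=> ab; have := lebesgue_measure_itv `[a, b[; rewrite /= lte_fin ab.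
Qed.

(** Each cell of length [N%:R^-1] that meets [Omega] contains a slope joining at
least [nu ^+ 2] pairs of sets; a given pair is joined only by slopes within
[8 / (N * d)] of each other, hence is counted by at most [8 / d + 2] cells. *)
Lemma slopes_at_scale (R : realType) (F : nat -> set (R * R)) (c : R)
    (J : nat -> Prop) (N b : nat) (d nu : R) (Omega : set R) :
  (forall j, (diam (F j) < c%:E)%E) ->
  (0 < N)%N -> 0 < d <= 1 -> 0 < nu ->
  (forall j, J j -> fine (diam (F j)) <= 2 / N%:R) ->
  (forall t, Omega t -> 0 <= t < 1 /\ exists2 S, has_slope t S &
     forall x, nu <= #|far_indices S F J b d x|%:R) ->
  (outer_lebesgue R Omega <=
   ((#|[set j : 'I_b | `[< J j >]]%SET|%:R / nu) ^+ 2 *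
    (10 / (d * N%:R)))%:E)%E.
Proof.
move=> Fc N0 /andP[d0 d1] nu0 JF Om.
have N0' : 0 < N%:R :> R by rewrite ltr0n.
pose cell (i : nat) : set R := `[i%:R / N%:R, i.+1%:R / N%:R]%classic.
pose G := [set g : 'I_N | `[< Omega `&` cell g !=set0 >]]%SET.
have /choice[T HT] : forall g : 'I_N, exists tS : R * set (R * R), g \in G ->
    [/\ cell g tS.1, 0 <= tS.1 < 1, has_slope tS.1 tS.2 &
        forall x, nu <= #|far_indices tS.2 F J b d x|%:R].
  move=> g; have [|gG] := boolP (g \in G); last by exists (0, set0).
  rewrite inE => /asboolP[t [Ot ct]]; have [t01 [S St Sx]] := Om t Ot.
  by exists (t, S).
pose M := [set j : 'I_b | `[< J j >]]%SET.
(* The far sets are found in two steps: a first one [i] is far from the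
   arbitrary point [0] and provides [p]; the others are far from [p]. *)
pose W g (i j : 'I_b) := `[< exists p q, [/\ F i p, (T g).2 p, F j q,
  (T g).2 q & d <= `|p.1 - q.1|] >].
have Gnu : #|G|%:R * nu ^+ 2 <= #|M|%:R ^+ 2 * (10 / d).
  apply: (double_count (W := W)).
  - move=> g gG; have [_ _ _ far] := HT g gG.
    apply: le_trans (_ : \sum_(i in far_indices (T g).2 F J b d 0) nu <= _).
      rewrite sumr_const -mulr_natr expr2; apply: ler_wpM2l; first exact: ltW.
      exact: far.
    rewrite [leLHS]big_mkcond [leRHS]big_mkcond; apply: ler_sum => i _.
    case: ifPn => [|_]; last by case: ifP => // _; apply: sumr_ge0.
    rewrite inE => /asboolP[Ji [p [Fp Tp] _]]; rewrite inE.
    case: asboolP => // _; apply: (le_trans (far p.1)).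
    rewrite -[leLHS]mulr1 mulr_natl -sumr_const.
    rewrite [leLHS]big_mkcond [leRHS]big_mkcond; apply: ler_sum => j _.
    case: ifPn => [|_]; last by case: ifP.
    rewrite inE => /asboolP[Jj [q [Fq Tq] dq]]; rewrite inE.
    case: asboolP => // _; rewrite /W; case: asboolP => // nW; case: nW.
    by exists p, q; split => //; rewrite distrC ltW.
  - move=> i j; rewrite !inE => Ji Jj.
    pose Gij := [set g in G | W g i j]%SET.
    have -> : \sum_(g in G) (W g i j)%:R = #|Gij|%:R :> R.
      rewrite -sum1_card natr_sum [LHS]big_mkcond [RHS]big_mkcond.
      by apply: eq_bigr => g _; rewrite [in RHS]inE; case: (g \in G);
        case: (W g i j).
    pose B := Num.truncn (8 / d + 1).
    have d8 : 0 <= 8 / d + 1 by rewrite addr_ge0 // divr_ge0 // ltW.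
    have Bd : B%:R <= 8 / d + 1 by rewrite truncn_le.
    (* Since [d <= 1], the [2] in [8 / d + 2] is absorbed by [2 / d]. *)
    have id : 1 <= d^-1 by rewrite invf_ge1.
    apply: le_trans (_ : B.+1%:R <= _); last by rewrite -natr1; lra.
    rewrite ler_nat; apply: card_le_spread => g g'.
    rewrite !inE => /andP[gG /asboolP[p [q [Fp Tp Fq Tq dpq]]]].
    move=> /andP[g'G /asboolP[p' [q' [Fp' Tp' Fq' Tq' _]]]].
    have [] := HT g; first by rewrite inE.
    rewrite /cell /= in_itv /= => /andP[cg1 cg2] t01 Sg _.
    have [] := HT g'; first by rewrite inE.
    rewrite /cell /= in_itv /= => /andP[cg1' cg2'] /andP[t0' t1'] Sg' _.
    have tt' : `|(T g').1 - (T g).1| * d <= 4 * (2 / N%:R).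
      apply: (@slope_close _ _ _ _ _ p q p' q') => //.
      - by rewrite ger0_norm // ltW.
      - exact: Sg.
      - exact: Sg'.
      - exact: le_trans (eucl_norm_le_diam (Fc i) Fp' Fp) (JF _ Ji).
      - exact: le_trans (eucl_norm_le_diam (Fc j) Fq' Fq) (JF _ Jj).
    suff : g%:R < g'%:R + B%:R + 1 :> R.
      by rewrite -natrD natr1 ltr_nat ltnS.
    have {}Bd : 8 / d < B%:R.
      by have : 8 / d + 1 < B.+1%:R := truncnS_gt _; rewrite -natr1; lra.
    have {}tt' : ((T g).1 - (T g').1) <= 8 / N%:R / d.
      rewrite ler_pdivlMr //.
      apply: le_trans (_ : 4 * (2 / N%:R) <= _); last lra.
      apply: le_trans tt'; apply: ler_wpM2r; first exact: ltW.
      by rewrite distrC ler_norm.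
    have {cg1}: g%:R <= (T g).1 * N%:R by rewrite -ler_pdivrMr.
    have {cg2'}: (T g').1 * N%:R <= g'%:R + 1 by rewrite natr1 -ler_pdivlMr.
    have : ((T g).1 - (T g').1) * N%:R <= 8 / d.
      rewrite -ler_pdivlMr //; apply: le_trans tt' _.
      by rewrite mulrAC.
    rewrite mulrBl; lra.
pose cellG (i : nat) : set R :=
  if `[< Omega `&` cell i !=set0 >] then cell i else set0.
have OG : Omega `<=` \big[setU/set0]_(i < N) cellG i.
  move=> t Ot; have [/andP[t0 t1] _] := Om t Ot.
  have tN : 0 <= t * N%:R by rewrite mulr_ge0 // ltW.
  have ct : cell (Num.truncn (t * N%:R)) t.
    rewrite /cell /= in_itv /= ler_pdivrMr // ler_pdivlMr // truncn_le // tN /=.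
    exact/ltW/truncnS_gt.
  rewrite -bigcup_mkord; exists (Num.truncn (t * N%:R)) => /=.
    by rewrite truncn_lt_nat // gtr_pMl.
  by rewrite /cellG; case: asboolP => // -[]; exists t.
apply: le_trans (le_outer_measure (outer_lebesgue R) _ _ OG) _.
apply: le_trans (outer_measure_subadditive (outer_lebesgue R) cellG N) _.
rewrite [leLHS](_ : _ = (\sum_(g < N) if g \in G then N%:R^-1 else 0)%:E).
  rewrite -big_mkcond sumr_const lee_fin -[leLHS]mulr_natl.
  move: Gnu; rewrite -ler_pdivlMr ?exprn_gt0 // => Gnu.
  apply: le_trans (ler_wpM2r _ Gnu) _; first by rewrite invr_ge0 ltW.
  rewrite le_eqVlt; apply/orP; left; apply/eqP.
  by field; rewrite !gt_eqF.
rewrite -sumEFin; apply: eq_bigr => g _; rewrite inE /cellG.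
case: asboolP => _; last exact: outer_measure0.
rewrite /cell outer_lebesgue_itvcc; last first.
  by rewrite ler_pM2r ?invr_gt0 // ler_nat.
by rewrite -mulrBl -natr1 addrAC subrr add0r mul1r.
Qed.

(** * Covers of small mass *)

Lemma dyadic_scale (R : realType) (r : R) : 0 < r < 1 ->
  exists k, (2 ^ k.+1)%:R^-1 <= r <= 2 / (2 ^ k.+1)%:R.
Proof.
move=> /andP[r0 r1].
have ex : exists n, (2 ^ n)%:R^-1 <= r.
  exists (Num.truncn r^-1).+1.
  rewrite -[leRHS]invrK lef_pV2 ?posrE ?invr_gt0 //.
  apply/ltW/(lt_le_trans (truncnS_gt _)); rewrite ler_nat.
  exact/ltnW/ltn_expl.
case: (ex_minnP ex) => -[|k] kr kmin.
  by move: kr; rewrite expn0 invr1 leNgt r1.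
exists k; rewrite kr /=; have : ~~ ((2 ^ k)%:R^-1 <= r).
  by apply/negP => /kmin; rewrite ltnn.
rewrite -ltNge => /ltW/le_trans -> //.
by rewrite expnS natrM invfM mulrA mulfV ?mul1r // pnatr_eq0.
Qed.

(** Applied with [v j] the mass of the [j]-th set of a cover, this shows that
each scale contains finitely many sets. *)
Lemma bounded_series_finite_index (R : realType) (v : nat -> R) (e H : R) :
  (forall j, 0 <= v j) -> (forall n, \sum_(j < n) v j <= e) -> 0 < H ->
  exists b, forall j, H <= v j -> (j < b)%N.
Proof.
move=> v0 ve H0; have cv : cvgn (series v).
  apply: nondecreasing_is_cvgn.
    by apply/nondecreasing_seqP => n; rewrite seriesSr lerDl.
  by exists e => _ [n _ <-]; rewrite /series /= big_mkord.
have /cvgrPdist_lt/(_ H H0)[b _ bH] := cvg_series_cvg_0 cv.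
exists b => j Hj; rewrite ltnNge; apply/negP => /bH /=.
by rewrite sub0r normrN ger0_norm // ltNge Hj.
Qed.

(** With [M k] sets at scale [k], the bound at scale [k] has the form
[K * (M k * H k) ^+ 2], which is at most [K * e * (M k * H k)]; the sum of the
[M k * H k] over [k] is at most the mass [e] of the cover. *)
Lemma sparse_cover_few_slopes (R : realType) (alpha c e K : R) (h : R -> R)
    (E : set (R * R)) (F : nat -> set (R * R)) (a d H : nat -> R)
    (Omega : set R) :
  0 < alpha -> e <= c -> e <= 1 -> 0 <= K ->
  (forall x, 0 <= x -> 0 <= h x) ->
  (forall x y, 0 <= x -> x <= y -> h x <= h y) ->
  (forall k, 0 < H k) ->
  (forall k, (2 ^ k.+1)%:R^-1 < e -> H k <= h (2 ^ k.+1)%:R^-1) ->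
  (forall k, 0 < a k) ->
  (forall k, [/\ 0 < d k <= 1, 4 * d k < c & (4 * d k) `^ alpha <= a k]) ->
  (forall N, \sum_(k < N) a k < c / 2) ->
  (forall k, 10 / (d k * (2 ^ k.+1)%:R) *
     ((2 / (2 ^ k.+1)%:R) `^ alpha / a k) ^+ 2 <= K * H k ^+ 2) ->
  (forall t, Omega t -> 0 <= t < 1 /\ exists S, [/\ S `<=` E, has_slope t S &
     massive (fun x => x `^ alpha) c S]) ->
  E `<=` \bigcup_j F j -> (forall j, (diam (F j) < e%:E)%E) ->
  (forall n, \sum_(j < n) h (fine (diam (F j))) <= e) ->
  (outer_lebesgue R Omega <= (K * e ^+ 2)%:E)%E.
Proof.
move=> alpha0 ec e1 K0 h0 hmono H0 Hh a0 Hd Ha HK HO EF Fe he.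
have Fc j : (diam (F j) < c%:E)%E.
  by apply: (lt_le_trans (Fe j)); rewrite lee_fin.
pose r j := fine (diam (F j)); pose rho k : R := (2 ^ k.+1)%:R^-1.
have rho0 k : 0 < rho k by rewrite invr_gt0 ltr0n expn_gt0.
have re j : r j < e by rewrite -lte_fin /r (fin_diam (Fe j)).
have /choice[kf Hkf] : forall j, exists k, 0 < r j -> rho k <= r j <= 2 * rho k.
  move=> j; have [rj|rj] := ltP 0 (r j); last by exists 0%N.
  have [|k Hk] := @dyadic_scale R (r j); last by exists k.
  by rewrite rj (lt_le_trans (re j)).
have Hkh j : 0 < r j -> H (kf j) <= h (r j).
  move=> rj; have /andP[kr _] := Hkf j rj.
  apply: le_trans (Hh _ (le_lt_trans kr (re j))) _.
  by apply: hmono kr; exact: ltW.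
pose v j := h (r j).
have v0 j : 0 <= v j by rewrite /v h0 // fine_diam_ge0.
have /choice[b Hb] : forall k, exists b, forall j, H k <= v j -> (j < b)%N.
  by move=> k; exact: bounded_series_finite_index v0 he (H0 k).
pose J k j := 0 < r j /\ kf j = k.
have Jb k j : J k j -> (j < b k)%N.
  by move=> [rj <-]; apply: Hb; exact: Hkh.
pose M k : R := #|[set j : 'I_(b k) | `[< J k j >]]%SET|%:R.
have MH N : \sum_(k < N) M k * H k <= e.
  pose bm := \max_(k < N) b k.
  apply: le_trans (he bm).
  apply: le_trans (_ : \sum_(k < N) \sum_(j < bm | kf j == k) v j <= _).
    apply: ler_sum => k _; rewrite /M mulr_natl -sumr_const.
    under eq_bigl do rewrite inE.
    apply: le_trans (_ : \sum_(j < b k | `[< J k j >]) v j <= _).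
      by apply: ler_sum => j /asboolP[rj jk]; have := Hkh j rj; rewrite jk.
    apply: le_trans (_ : \sum_(j < bm | `[< J k j >]) v j <= _).
      apply: (sum_ord_le (Q := fun j => `[< J k j >])) => // j /asboolP/Jb jb.
      exact: leq_trans jb (leq_bigmax k).
    rewrite [leLHS]big_mkcond [leRHS]big_mkcond; apply: ler_sum => j _.
    by case: asboolP => [[_ ->]|_]; rewrite ?eqxx //; case: ifP.
  rewrite (exchange_big_dep predT) //=; apply: ler_sum => j _.
  have [jN|jN] := ltnP (kf j) N; first by rewrite sum_fiber.
  rewrite big_pred0 => [|k]; first exact: v0.
  by apply/eqP => jk; move: (ltn_ord k); rewrite -jk ltnNge jN.
have MH0 k : 0 <= M k * H k by rewrite mulr_ge0 // ltW.
have MHe k : M k * H k <= e.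
  by apply: le_trans (MH k.+1); rewrite big_ord_recr /= lerDr sumr_ge0.
pose Ok k := [set t | Omega t /\ exists2 S, has_slope t S & forall x,
  a k / (2 * rho k) `^ alpha <= #|far_indices S F (J k) (b k) (d k) x|%:R].
have u0 k : 0 < (2 * rho k) `^ alpha by rewrite powR_gt0 // mulr_gt0.
have OOk : Omega `<=` \bigcup_k Ok k.
  move=> t Ot; have [/andP[t0 t1] [S [SE St Sm]]] := HO t Ot.
  have [||||k Hk] := @scale_pigeonhole R alpha t c S F kf b a d
    (fun k => 2 * rho k) alpha0 _ St Sm _ Fc _ _ Ha.
  - by rewrite ger0_norm // ltW.
  - exact: subset_trans SE EF.
  - by move=> j rj; split; [exact: Jb|have /andP[] := Hkf j rj].
  - by move=> k; have [/andP[/ltW]] := Hd k.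
  exists k => //; split=> //; exists S => // x.
  by rewrite ler_pdivrMr.
apply: le_trans (le_outer_measure (outer_lebesgue R) _ _ OOk) _.
apply: le_trans (outer_measure_sigma_subadditive (outer_lebesgue R) Ok) _.
have OkM k : (outer_lebesgue R (Ok k) <= (K * e * (M k * H k))%:E)%E.
  apply: le_trans (@slopes_at_scale R F c (J k) (2 ^ k.+1) (b k) (d k)
     (a k / (2 * rho k) `^ alpha) (Ok k) Fc _ _ _ _ _) _.
  - by rewrite expn_gt0.
  - by have [] := Hd k.
  - by rewrite divr_gt0.
  - by move=> j [rj <-]; have /andP[] := Hkf j rj.
  - by move=> t [Ot [S St Sx]]; split; [have [] := HO t Ot | exists S].
  rewrite lee_fin -/(M k).
  apply: le_trans (_ : M k ^+ 2 * (K * H k ^+ 2) <= _).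
    rewrite expr_div_n -mulrA ler_wpM2l ?sqr_ge0 //.
    by rewrite -exprVn invf_div mulrC; exact: HK.
  rewrite mulrCA -exprMn expr2 -[leRHS]mulrA ler_wpM2l //.
  by rewrite ler_wpM2r.
apply: (@le_trans _ _ (\sum_(0 <= k <oo) (K * e * (M k * H k))%:E)%E).
  by apply: lee_nneseries => // k _ _; exact: outer_measure_ge0.
apply: lime_le.
  apply: is_cvg_nneseries => k _ _.
  exact: le_trans (outer_measure_ge0 _ _) (OkM k).
apply: nearW => n; rewrite big_mkord sumEFin lee_fin -mulr_sumr.
rewrite expr2 mulrA; apply: ler_wpM2l; last exact: MH.
by rewrite mulr_ge0 // (le_trans (MH0 0%N)).
Qed.

(** * Choice of the thresholds *)

(** The convexity inequality behind the comparison of the series of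
[x `^ (- p)] with a telescoping one. *)
Lemma powR_telescope (R : realType) (x s : R) : 1 < x -> 0 < s ->
  s * x `^ (- (s + 1)) <= (x - 1) `^ (- s) - x `^ (- s).
Proof.
move=> x1 s0; have x0 : 0 < x by lra.
have xi : x^-1 < 1 by rewrite invf_lt1.
have xi0 : 0 < x^-1 by rewrite invr_gt0.
have q0 : 0 < 1 - x^-1 by lra.
have -> : x - 1 = x * (1 - x^-1) by field; rewrite gt_eqF.
rewrite powRM ?(ltW x0) ?(ltW q0) //.
rewrite opprD powRD; last by rewrite (gt_eqF x0) implybT.
rewrite powR_inv1 ?(ltW x0) //.
have X0 : 0 <= x `^ (- s) by exact: powR_ge0.
suff : 1 + s * x^-1 <= (1 - x^-1) `^ (- s).
  by move=> /(ler_wpM2l X0); lra.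
rewrite /powR gt_eqF //; apply: le_trans (expR_ge1Dx _).
rewrite lerD2l mulNr -mulrN; apply: ler_wpM2l; first exact: ltW.
by rewrite lerNr; apply: le_ln1Dx; lra.
Qed.

Lemma pseries_bounded (R : realType) (p : R) : 1 < p ->
  exists2 B, 1 <= B & forall N, \sum_(k < N) k.+1%:R `^ (- p) <= B.
Proof.
move=> p1; pose s := p - 1; have s0 : 0 < s by rewrite subr_gt0.
have si : 0 <= s^-1 by rewrite invr_ge0 ltW.
exists (1 + s^-1); first by lra.
have H N : \sum_(k < N.+1) k.+1%:R `^ (- p) <=
    1 + s^-1 * (1 - N.+1%:R `^ (- s)).
  elim: N => [|N IH].
    by rewrite big_ord1 !powR1 subrr mulr0 addr0.
  rewrite big_ord_recr /=.
  have x1 : (1 : R) < N.+2%:R by rewrite ltr1n.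
  have := powR_telescope x1 s0; rewrite subrK -[X in X - 1]natr1 addrK.
  move=> /(ler_wpM2l si); rewrite mulKf ?gt_eqF // => tel.
  apply: le_trans (lerD IH tel) _.
  by rewrite le_eqVlt; apply/orP; left; apply/eqP; ring.
move=> [|N]; first by rewrite big_ord0; lra.
by apply: le_trans (H N) _; rewrite lerD2l ler_piMr.
Qed.

(** Here [a k = eta * k.+1 `^ (- p)] and [4 * d k = a k `^ alpha^-1]. The last
inequality is in fact an equality: the powers of [rho] agree, and
[p * (2 + alpha^-1) = 2 * theta] makes the powers of [k.+1] agree. *)
Lemma threshold_sequences (R : realType) (alpha theta c C : R) :
  0 < alpha -> (1 + 2 * alpha) / (2 * alpha) < theta -> 0 < c -> 0 < C ->
  exists (a d : nat -> R) (K : R), [/\ forall k, 0 < a k,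
    forall k, [/\ 0 < d k <= 1, 4 * d k < c & (4 * d k) `^ alpha <= a k],
    forall N, \sum_(k < N) a k < c / 2,
    0 <= K &
    forall k, let rho := (2 ^ k.+1)%:R^-1 in
    10 / (d k * (2 ^ k.+1)%:R) * ((2 / (2 ^ k.+1)%:R) `^ alpha / a k) ^+ 2 <=
    K * (C * rho `^ alpha * Num.sqrt rho * ln (1 / rho) `^ theta) ^+ 2].
Proof.
move=> al0 hth c0 C0.
pose p := 2 * alpha * theta / (1 + 2 * alpha).
have p1 : 1 < p.
  rewrite /p ltr_pdivlMr ?mul1r; last by lra.
  by move: hth; rewrite ltr_pdivrMr; last lra; rewrite [theta * _]mulrC.
have [B B1 HB] := pseries_bounded p1.
(* The three terms give [a k <= 1], the bound on the sums of [a], and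
   [4 * d k <= c / 2]. *)
pose eta := Num.min 1 (Num.min (c / (4 * B)) ((c / 2) `^ alpha)).
have eta0 : 0 < eta.
  rewrite !lt_min ltr01 powR_gt0 ?divr_gt0 ?andbT // mulr_gt0 //; lra.
have eta1 : eta <= 1 by rewrite ge_min lexx.
have etaB : eta * B <= c / 4.
  rewrite -ler_pdivlMr; last lra.
  by rewrite -mulrA -invfM /eta !ge_min lexx /= orbT.
have etac : eta <= (c / 2) `^ alpha by rewrite !ge_min lexx !orbT.
pose x k : R := k.+1%:R.
have x1 k : 1 <= x k by rewrite ler1n.
have x0 k : 0 < x k by rewrite ltr0n.
pose a k := eta * x k `^ (- p).
pose d k := a k `^ alpha^-1 / 4.
have a0 k : 0 < a k by rewrite mulr_gt0 // powR_gt0.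
have aeta k : a k <= eta.
  rewrite /a ler_piMr ?(ltW eta0) // powRN invf_le1 ?powR_gt0 //.
  by rewrite -[leLHS](powRr0 (x k)) ler_powR // ltW // (lt_trans _ p1).
have d4 k : 4 * d k = a k `^ alpha^-1 by rewrite /d; field.
have ali : 0 <= alpha^-1 by rewrite invr_ge0 ltW.
have dr (y : R) k : 0 <= y -> a k <= y `^ alpha -> 4 * d k <= y.
  move=> y0 ay; rewrite d4; have -> : y = (y `^ alpha) `^ alpha^-1.
    by rewrite -powRrM divff ?powRr1 // gt_eqF.
  by apply: ge0_ler_powR; rewrite ?nnegrE ?powR_ge0 // ltW.
exists a, d, (40 * (2 `^ alpha) ^+ 2 /
  (eta `^ alpha^-1 * eta ^+ 2 * C ^+ 2 * (ln 2 `^ theta) ^+ 2)).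
split => //.
- move=> k; split.
  + rewrite divr_gt0 ?powR_gt0 //=.
    have := @dr 1 k ler01; rewrite powR1 => /(_ (le_trans (aeta k) eta1)).
    by lra.
  + have c2 : 0 <= c / 2 by lra.
    have := dr (c / 2) k c2 (le_trans (aeta k) etac); lra.
  + by rewrite d4 -powRrM mulVf ?powRr1 ?gt_eqF // ltW.
- move=> N; rewrite -mulr_sumr; apply: le_lt_trans (_ : eta * B < _).
    by apply: ler_wpM2l; [exact: ltW | exact: HB].
  by apply: le_lt_trans etaB _; lra.
- by rewrite divr_ge0 // mulr_ge0 ?sqr_ge0 // mulr_ge0 ?sqr_ge0 //
    mulr_ge0 ?sqr_ge0 ?powR_ge0.
move=> k; rewrite /= div1r invrK.
have -> : ln (2 ^ k.+1)%:R = x k * ln 2 :> R.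
  by rewrite natrX lnXn // /x mulr_natl.
set N : R := (2 ^ k.+1)%:R; have N0 : 0 < N by rewrite ltr0n expn_gt0.
have ln20 : 0 < ln 2 :> R by rewrite ln_gt0 // ltr1n.
rewrite [(2 / N) `^ _]powRM ?invr_ge0 ?(ltW N0) //.
rewrite [(x k * _) `^ _]powRM ?(ltW ln20) ?(ltW (x0 k)) //.
have Wp : x k `^ (p / alpha) * (x k `^ p) ^+ 2 = (x k `^ theta) ^+ 2.
  rewrite -!powR_mulrn ?powR_ge0 // -!powRrM -powRD; last first.
    by rewrite (gt_eqF (x0 k)) implybT.
  congr (_ `^ _); rewrite /p; field.
  by rewrite !gt_eqF //; lra.
have -> : d k = eta `^ alpha^-1 / x k `^ (p / alpha) / 4.
  rewrite /d /a powRM ?powR_ge0 ?(ltW eta0) //.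
  by rewrite -powRrM mulNr powRN.
rewrite /a powRN.
rewrite le_eqVlt; apply/orP; left; apply/eqP.
have Ns : Num.sqrt N^-1 ^+ 2 = N^-1 by rewrite sqr_sqrtr // invr_ge0 ltW.
rewrite [RHS](_ : _ = 40 * 2 `^ alpha ^+ 2 /
  (eta `^ alpha^-1 * eta ^+ 2 * C ^+ 2 * ln 2 `^ theta ^+ 2) *
  (C ^+ 2 * (N^-1 `^ alpha) ^+ 2 * Num.sqrt N^-1 ^+ 2 *
   ((x k `^ theta) ^+ 2 * (ln 2 `^ theta) ^+ 2))); last by ring.
rewrite Ns -Wp.
have Wn0 : x k `^ (p / alpha) != 0 by rewrite gt_eqF ?powR_gt0.
have Vn0 : x k `^ p != 0 by rewrite gt_eqF ?powR_gt0.
have Zn0 : eta `^ alpha^-1 != 0 by rewrite gt_eqF ?powR_gt0.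
have Ln0 : ln 2 `^ theta != 0 :> R by rewrite gt_eqF ?powR_gt0.
move: (x k `^ (p / alpha)) (x k `^ p) (eta `^ alpha^-1) (ln 2 `^ theta)
  (N^-1 `^ alpha) (2 `^ alpha) Wn0 Vn0 Zn0 Ln0 => W V Z L A Y Wn0 Vn0 Zn0 Ln0.
by field; rewrite Wn0 Vn0 Zn0 Ln0 !gt_eqF.
Qed.

(** * Conclusion *)

Lemma outer_lebesgue_cover_gt0 (R : realType) (O : nat -> set R) :
  (`[0, 1[%classic : set R) `<=` \bigcup_m O m ->
  exists m, exists2 l : R, 0 < l & (l%:E <= outer_lebesgue R (O m))%E.
Proof.
move=> cov; apply: contrapT => nO.
have O0 m : outer_lebesgue R (O m) = 0%E.
  have := outer_measure_ge0 (outer_lebesgue R) (O m).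
  rewrite le_eqVlt => /predU1P[//|m0]; exfalso; apply: nO; exists m.
  case: (outer_lebesgue R (O m)) m0 => [l| |//] m0; first by exists l.
  by exists 1 => //; rewrite leey.
have := le_outer_measure (outer_lebesgue R) _ _ cov.
rewrite leNgt => /negP; apply.
rewrite outer_lebesgue_itvco ?ltr01 // subr0.
apply: le_lt_trans (outer_measure_sigma_subadditive (outer_lebesgue R) O) _.
by rewrite eseries0 ?lte_fin ?ltr01.
Qed.

Theorem corollary4p5 (R : realType) (alpha : R) (E : set (R * R)) (h : R -> R)
    (C theta : R) :
  0 < alpha -> alpha <= 1 ->
  Fplus_set alpha E ->
  dimension_function h ->
  0 < C ->
  (1 + 2 * alpha) / (2 * alpha) < theta ->
  (\forall x \near 0^'+,
     C * (x `^ alpha) * Num.sqrt x * (ln (1 / x)) `^ theta <= h x) ->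
  (0 < hausdorff h E)%E.
Proof.
move=> alpha0 _ FE [h0 hmono _ _] C0 htheta hC.
have [r0 r00 hr0] : exists2 r0, 0 < r0 & forall x, 0 < x < r0 ->
    C * (x `^ alpha) * Num.sqrt x * (ln (1 / x)) `^ theta <= h x.
  have [r /= r0 hr] := hC; exists r => // x /andP[x0 xr].
  by apply: hr => //=; rewrite sub0r normrN gtr0_norm.
have /choice[S HS] : forall t : R, exists S, [/\ S `<=` E, has_slope t S &
    exists2 c, 0 < c & massive (fun x => x `^ alpha) c S].
  move=> t; have [S [c [SE St c0 Sc]]] := Fplus_massive_slope FE t.
  by exists S; split => //; exists c.
pose Om (m : nat) := [set t : R | 0 <= t < 1 /\
  massive (fun x => x `^ alpha) m.+1%:R^-1 (S t)].
have [m [l l0 lOm]] : exists m, exists2 l : R, 0 < l &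
    (l%:E <= outer_lebesgue R (Om m))%E.
  apply: outer_lebesgue_cover_gt0 => t; rewrite /= in_itv /= => t01.
  have [_ _ [c c0 Sc]] := HS t.
  exists (Num.truncn c^-1) => //; split=> //; apply: massive_le Sc.
  rewrite -[leRHS]invrK lef_pV2 ?posrE ?invr_gt0 //.
  exact/ltW/truncnS_gt.
have c0 : 0 < m.+1%:R^-1 :> R by rewrite invr_gt0.
have [a [d [K [a0 Hd Ha K0 HK]]]] := threshold_sequences alpha0 htheta c0 C0.
pose H k := let rho : R := (2 ^ k.+1)%:R^-1 in
  C * rho `^ alpha * Num.sqrt rho * ln (1 / rho) `^ theta.
(* The factor [K + 1] keeps the last quotient meaningful when [K = 0]; it
   makes [K * e ^+ 2 < l]. *)
pose e := Num.min (Num.min m.+1%:R^-1 r0) (Num.min 1 (l / (2 * (K + 1)))).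
have K1 : 0 < 2 * (K + 1) by lra.
have e0 : 0 < e by rewrite !lt_min c0 r00 ltr01 divr_gt0.
have ec : e <= m.+1%:R^-1 by rewrite !ge_min lexx.
have er : e <= r0 by rewrite !ge_min lexx orbT.
have e1 : e <= 1 by rewrite !ge_min lexx /= orbT.
have el : e * (2 * (K + 1)) <= l.
  by rewrite -ler_pdivlMr // !ge_min lexx !orbT.
apply/(hausdorff_gt0P _ h0); exists e => // F EF Fe.
apply: contrapT => /forallNP nF.
suff : (outer_lebesgue R (Om m) <= (K * e ^+ 2)%:E)%E.
  move=> /(le_trans lOm); rewrite lee_fin; apply/negP; rewrite -ltNge.
  have : K * (e * e) <= K * (1 * e) by rewrite !ler_wpM2l // ler_wpM2r // ltW.
  rewrite expr2; have := mulr_ge0 K0 (ltW e0); lra.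
apply: (@sparse_cover_few_slopes _ alpha m.+1%:R^-1 e K h E F a d H) => //.
- move=> k; have rho0 : 0 < (2 ^ k.+1)%:R^-1 :> R.
    by rewrite invr_gt0 ltr0n expn_gt0.
  rewrite /H /= !mulr_gt0 ?powR_gt0 ?sqrtr_gt0 //.
  by rewrite div1r invrK ln_gt0 // ltr1n -{1}(expn0 2) ltn_exp2l.
- move=> k ke; apply: hr0; rewrite (lt_le_trans ke er) andbT.
  by rewrite invr_gt0 ltr0n expn_gt0.
- move=> t [t01 tm]; split=> //; exists (S t).
  by have [? ? _] := HS t; split.
- by move=> n; have /negP := nF n; rewrite -ltNge => /ltW.
Qed.
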